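(* Let $n\ge 2$ and let $S_n$ be the set of all $n\times n$ real symmetric matrices. Every matrix interval $J\subset S_n$ is order isomorphic to one of the following matrix intervals in $S_n$: $[0,I]$, $[0, \infty)$, $(-\infty, 0]$, $(0, \infty)$, and $(-\infty , \infty )$.
   Context: For $A,B\in S_n$, $A\le B$ means that $B-A$ is positive semidefinite and $A<B$ means that $B-A$ is positive definite (positive semidefinite and invertible). $0$ and $I$ denote the $n\times n$ zero and identity matrices. Matrix intervals are the following subsets of $S_n$. For $A,B\in S_n$ with $A<B$: $[A,B]=\{C\in S_n: A\le C\le B\}$, $[A,B)=\{C\in S_n: A\le C<B\}$, $(A,B]=\{C\in S_n: A<C\le B\}$, $(A,B)=\{C\in S_n: A<C<B\}$. For $A\in S_n$: $[A,\infty)=\{C\in S_n: C\ge A\}$, $(A,\infty)=\{C\in S_n: C>A\}$, $(-\infty,A]=\{C\in S_n: C\le A\}$, $(-\infty,A)=\{C\in S_n: C<A\}$. Finally $(-\infty,\infty)=S_n$. Two subsets $M,N\subset S_n$ are order isomorphic if there is a bijection $\phi:M\to N$ such that for all $X,Y\in M$: $X\le Y\iff\phi(X)\le\phi(Y)$. *)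

(* Defs.v *)
From HB Require Import structures.
From mathcomp Require Import all_boot all_order all_algebra.
From mathcomp Require Import sesquilinear.
From mathcomp Require Import boolp classical_sets functions reals.

Set Implicit Arguments.
Unset Strict Implicit.
Unset Printing Implicit Defensive.

Import Order.TTheory GRing.Theory Num.Theory.
Local Open Scope classical_set_scope.
Local Open Scope ring_scope.

Definition Sym (R : realType) (n : nat) : set 'M[R]_n :=
  [set A | A \is symmetricmx].

Definition psdmx (R : realType) (n : nat) (A : 'M[R]_n) : Prop :=
  A \is symmetricmx /\ forall x : 'cV[R]_n, 0 <= (x^T *m A *m x) 0 0.

Definition pdmx (R : realType) (n : nat) (A : 'M[R]_n) : Prop :=
  psdmx A /\ A \in unitmx.

(* The Loewner order; [mxlt A B] is stronger than [mxle A B /\ A <> B]. *)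
Definition mxle (R : realType) (n : nat) (A B : 'M[R]_n) : Prop :=
  psdmx (B - A).

Definition mxlt (R : realType) (n : nat) (A B : 'M[R]_n) : Prop :=
  pdmx (B - A).

(* Letters give the left and right ends: c = closed, o = open, i = infinite. *)
Definition mxitv_cc (R : realType) (n : nat) (A B : 'M[R]_n) : set 'M[R]_n :=
  [set C | Sym C /\ mxle A C /\ mxle C B].
Definition mxitv_co (R : realType) (n : nat) (A B : 'M[R]_n) : set 'M[R]_n :=
  [set C | Sym C /\ mxle A C /\ mxlt C B].
Definition mxitv_oc (R : realType) (n : nat) (A B : 'M[R]_n) : set 'M[R]_n :=
  [set C | Sym C /\ mxlt A C /\ mxle C B].
Definition mxitv_oo (R : realType) (n : nat) (A B : 'M[R]_n) : set 'M[R]_n :=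
  [set C | Sym C /\ mxlt A C /\ mxlt C B].
Definition mxitv_ci (R : realType) (n : nat) (A : 'M[R]_n) : set 'M[R]_n :=
  [set C | Sym C /\ mxle A C].
Definition mxitv_oi (R : realType) (n : nat) (A : 'M[R]_n) : set 'M[R]_n :=
  [set C | Sym C /\ mxlt A C].
Definition mxitv_ic (R : realType) (n : nat) (A : 'M[R]_n) : set 'M[R]_n :=
  [set C | Sym C /\ mxle C A].
Definition mxitv_io (R : realType) (n : nat) (A : 'M[R]_n) : set 'M[R]_n :=
  [set C | Sym C /\ mxlt C A].
Definition mxitv_ii (R : realType) (n : nat) : set 'M[R]_n := @Sym R n.
Arguments mxitv_ii : clear implicits.

Variant matrix_interval (R : realType) (n : nat) : set 'M[R]_n -> Prop :=
| Mxitv_cc (A B : 'M[R]_n) of Sym A & Sym B & mxlt A B :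
    matrix_interval (mxitv_cc A B)
| Mxitv_co (A B : 'M[R]_n) of Sym A & Sym B & mxlt A B :
    matrix_interval (mxitv_co A B)
| Mxitv_oc (A B : 'M[R]_n) of Sym A & Sym B & mxlt A B :
    matrix_interval (mxitv_oc A B)
| Mxitv_oo (A B : 'M[R]_n) of Sym A & Sym B & mxlt A B :
    matrix_interval (mxitv_oo A B)
| Mxitv_ci (A : 'M[R]_n) of Sym A : matrix_interval (mxitv_ci A)
| Mxitv_oi (A : 'M[R]_n) of Sym A : matrix_interval (mxitv_oi A)
| Mxitv_ic (A : 'M[R]_n) of Sym A : matrix_interval (mxitv_ic A)
| Mxitv_io (A : 'M[R]_n) of Sym A : matrix_interval (mxitv_io A)
| Mxitv_ii : matrix_interval (mxitv_ii R n).

(* [phi] is a total function, but only its restriction to [M] matters. *)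
Definition order_isomorphic (R : realType) (n : nat) (M N : set 'M[R]_n) :
    Prop :=
  exists phi : 'M[R]_n -> 'M[R]_n,
    set_bij M N phi /\
    forall X Y : 'M[R]_n, M X -> M Y -> (mxle X Y <-> mxle (phi X) (phi Y)).

(* Main.v *)
(* Inversion reverses both orders on the positive definite matrices, and so does
   X |-> C - X on S_n. With D = B - A, composing such maps gives isomorphisms
     X |-> (B - X)^-1 - D^-1         from [A,B) onto [0,oo),
     X |-> D^-1 - (X - A)^-1         from (A,B] onto (-oo,0],
     X |-> ((X - A)^-1 - D^-1)^-1    from (A,B) onto (0,oo),
     X |-> (A - X)^-1                from (-oo,A) onto (0,oo).
   For [A,B], choose P with P^T D P = I and use X |-> P^T (X - A) P. The
   remaining cases are translations. *)

Require Import Defs.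
From HB Require Import structures.
From mathcomp Require Import all_boot all_order all_algebra.
From mathcomp Require Import boolp classical_sets functions reals.
From mathcomp Require Import sesquilinear ring lra.

Import Order.TTheory GRing.Theory Num.Theory.
Local Open Scope classical_set_scope.
Local Open Scope ring_scope.

(** * Positive semidefinite matrices *)

Lemma symmxP {R : realType} {n : nat} (A : 'M[R]_n) :
  A \is symmetricmx <-> A^T = A.
Proof.
have idE : (A ^t idfun)%sesqui = A^T by apply/matrixP => i j; rewrite !mxE.
by rewrite qualifE expr0 scale1r idE; split=> [/eqP | ->].
Qed.

Lemma psdmx_tr {R : realType} {n : nat} {A : 'M[R]_n} : psdmx A -> A^T = A.
Proof. by case=> /symmxP. Qed.

Lemma psdmx_add {R : realType} {n : nat} (A B : 'M[R]_n) :
  psdmx A -> psdmx B -> psdmx (A + B).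
Proof.
move=> [/symmxP sA pA] [/symmxP sB pB]; split.
  by apply/symmxP; rewrite linearD /= sA sB.
by move=> x; rewrite mulmxDr mulmxDl mxE addr_ge0.
Qed.

Lemma psdmx_congr {R : realType} {m n : nat} (P : 'M[R]_(n, m)) (A : 'M[R]_n) :
  psdmx A -> psdmx (P^T *m A *m P).
Proof.
move=> [/symmxP sA pA]; split.
  by apply/symmxP; rewrite !trmx_mul trmxK sA mulmxA.
by move=> x; have := pA (P *m x); rewrite trmx_mul !mulmxA.
Qed.

Lemma cVdot_eq0 {R : realType} {n : nat} (w : 'cV[R]_n) :
  (w^T *m w) 0 0 = 0 -> w = 0.
Proof.
rewrite mxE => /eqP; rewrite psumr_eq0; last first.
  by move=> i _; rewrite mxE -expr2 sqr_ge0.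
move=> /allP w0; apply/matrixP => i j; rewrite (ord1 j) mxE.
have := w0 i (mem_index_enum i).
by rewrite /= mxE mulf_eq0 orbb => /eqP.
Qed.

(* Evaluate the form at [x - t A x]: its value [t^2 r - 2 t q], where
   [q = |A x|^2], is nonnegative for all t only if [q = 0]. *)
Lemma psdmx_ker {R : realType} {n : nat} (A : 'M[R]_n) (x : 'cV[R]_n) :
  psdmx A -> (x^T *m A *m x) 0 0 = 0 -> A *m x = 0.
Proof.
move=> psdA x0; have sA := psdmx_tr psdA; case: psdA => _ pA.
apply: cVdot_eq0; set w := A *m x; set q := (w^T *m w) 0 0.
pose r := (w^T *m A *m w) 0 0; have r0 : 0 <= r := pA w.
have qE : (x^T *m A *m w) 0 0 = q by rewrite /q {2}/w trmx_mul sA.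
have qE' : (w^T *m A *m x) 0 0 = q by rewrite -mulmxA.
have form t : 0 <= t * (t * r) - t * q *+ 2.
  have := pA (x - t *: w).
  have -> : (x - t *: w)^T = x^T - t *: w^T by rewrite linearB linearZ.
  rewrite !mulmxBl !mulmxBr -!scalemxAl -!scalemxAr.
  have mx00B (U V : 'M[R]_1) : (U - V) 0 0 = U 0 0 - V 0 0 by rewrite !mxE.
  have mx00Z c (U : 'M[R]_1) : (c *: U) 0 0 = c * U 0 0 by rewrite !mxE.
  rewrite !(mx00B, mx00Z) x0 qE qE' -/r.
  by congr (0 <= _); ring.
(* Near the minimizer [q / r], but with [r + 1] so that the denominator stays positive when [r = 0].
   As [q = t * d], the value at [t = q / d] is [- t ^+ 2 * (r + 2)], which is nonnegative only if
   [t = 0]. *)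
have := form (q / (r + 1)); set d := r + 1.
have d0 : 0 < d by rewrite /d; lra.
have -> : q / d * (q / d * r) - q / d * q *+ 2 = - ((q / d) ^+ 2 * (r + 2)).
  by rewrite /d; field; apply: lt0r_neq0.
rewrite oppr_ge0 pmulr_lle0; last lra.
move=> le0; have /eqP : (q / d) ^+ 2 = 0.
  by apply/eqP; rewrite eq_le le0 sqr_ge0.
by rewrite expf_eq0 /= mulf_eq0 invr_eq0 (gt_eqF d0) orbF => /eqP.
Qed.

(** * Positive definite matrices and their inverses *)

Lemma unitmx_ker0 {R : realType} {n : nat} (A : 'M[R]_n) :
  (forall x : 'cV[R]_n, A *m x = 0 -> x = 0) -> A \in unitmx.
Proof.
(* [kermx] consists of row vectors, so it is taken of [A^T]: its rows, transposed, are columns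
   killed by [A]. *)
move=> kerA; rewrite -unitmx_tr -row_free_unit -kermx_eq0.
apply/eqP/row_matrixP => i; rewrite row0; apply: trmx_inj; rewrite trmx0.
by apply: kerA; rewrite -{1}[A]trmxK -trmx_mul -row_mul mulmx_ker row0 trmx0.
Qed.

(** If [(A + B) x = 0], two nonnegative values with sum 0 both vanish at [x]; [psdmx_ker] then gives
    [A x = 0], and [x = 0] since [A] is invertible. *)
Lemma pdmx_add_psd {R : realType} {n : nat} (A B : 'M[R]_n) :
  pdmx A -> psdmx B -> pdmx (A + B).
Proof.
move=> [pA uA] pB; split; first exact: psdmx_add.
apply: unitmx_ker0 => x ABx0.
suff xAx : (x^T *m A *m x) 0 0 = 0.
  by rewrite -[x](mulKmx uA) (psdmx_ker _ _ pA xAx) mulmx0.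
have : (x^T *m A *m x) 0 0 + (x^T *m B *m x) 0 0 = 0.
  rewrite -!mulmxA; have := congr1 (fun y => (x^T *m y) 0 0) ABx0.
  by rewrite mulmxDl mulmxDr mulmx0 !mxE.
move/eqP; rewrite paddr_eq0; [|exact: pA.2|exact: pB.2].
by case/andP => /eqP.
Qed.

Lemma pdmx_congr {R : realType} {n : nat} (P A : 'M[R]_n) :
  P \in unitmx -> pdmx A -> pdmx (P^T *m A *m P).
Proof.
move=> uP [pA uA]; split; first exact: psdmx_congr.
by rewrite !unitmx_mul unitmx_tr uP uA.
Qed.

(** [A^-1 = A^-1 A A^-1] is a congruence of [A], because [A^-1] is symmetric. *)
Lemma pdmx_inv {R : realType} {n : nat} {A : 'M[R]_n} :
  pdmx A -> pdmx (invmx A).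
Proof.
move=> [pA uA]; have := pdmx_congr (invmx A) A; rewrite unitmx_inv.
by rewrite trmx_inv (psdmx_tr pA) mulVmx // mul1mx; apply.
Qed.

(* X^-1 - Y^-1 =
   (X^-1 - Y^-1) X (X^-1 - Y^-1) + Y^-1 (Y - X) Y^-1. *)
Lemma mxle_inv {R : realType} {n : nat} (X Y : 'M[R]_n) :
  pdmx X -> pdmx Y -> mxle (invmx X) (invmx Y) = mxle Y X.
Proof.
suff half (U V : 'M[R]_n) : pdmx U -> pdmx V -> mxle U V ->
    mxle (invmx V) (invmx U).
  move=> pX pY; apply/propext; split; last exact: half.
  by move=> /half; rewrite !invmxK; apply; exact: pdmx_inv.
move=> [pU uU] [pV uV] leUV; rewrite /mxle.
have sU : (invmx U)^T = invmx U by rewrite trmx_inv (psdmx_tr pU).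
have sV : (invmx V)^T = invmx V by rewrite trmx_inv (psdmx_tr pV).
have sUV : (invmx U - invmx V)^T = invmx U - invmx V.
  by rewrite linearB /= sU sV.
have -> : invmx U - invmx V =
    (invmx U - invmx V)^T *m U *m (invmx U - invmx V)
    + (invmx V)^T *m (V - U) *m invmx V.
  rewrite sUV sV mulmxBl mulVmx // mulmxBr mulmxBl !mul1mx.
  rewrite mulmxBl -(mulmxA _ _ (invmx U)) mulmxV // mulmx1.
  rewrite !mulmxBr mulVmx // mulmxBl mul1mx.
  set a := invmx U; set b := invmx V.
  by apply/matrixP => i j; rewrite !mxE; ring.
by apply: psdmx_add; exact: psdmx_congr.
Qed.

(** The semidefinite half is [mxle_inv]; the factorization [Y^-1 - X^-1 = Y^-1 (X - Y) X^-1] makes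
    both differences invertible together. *)
Lemma mxlt_inv {R : realType} {n : nat} (X Y : 'M[R]_n) :
  pdmx X -> pdmx Y -> mxlt (invmx X) (invmx Y) = mxlt Y X.
Proof.
move=> pX pY; rewrite /mxlt /pdmx; congr (_ /\ _).
  exact: mxle_inv.
have [uX uY] := (pX.2, pY.2).
have -> : invmx Y - invmx X = invmx Y *m (X - Y) *m invmx X.
  by rewrite mulmxBr mulVmx // mulmxBl mul1mx -mulmxA mulmxV // mulmx1.
by rewrite !unitmx_mul !unitmx_inv uX uY andbT.
Qed.

(** * Translation, reflection and reduction to the identity by congruence *)

Lemma mxle_sub2r {R : realType} {n : nat} (C X Y : 'M[R]_n) :
  mxle (X - C) (Y - C) = mxle X Y.
Proof. by rewrite /mxle opprB addrA subrK. Qed.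

Lemma mxle_sub2l {R : realType} {n : nat} (C X Y : 'M[R]_n) :
  mxle (C - X) (C - Y) = mxle Y X.
Proof. by rewrite /mxle opprB addrC addrA subrK. Qed.

(* Cholesky: block elimination of the first row and column leaves the Schur
   complement, which is again positive definite. *)
Lemma pdmx_congr_id {R : realType} {n : nat} (D : 'M[R]_n) :
  pdmx D -> exists2 P : 'M[R]_n, P \in unitmx & P^T *m D *m P = 1%:M.
Proof.
elim: n D => [|n IHn] D pD.
  by exists 1%:M; rewrite ?unitmx1 // [RHS]flatmx0 [LHS]flatmx0.
move: D pD; change n.+1 with (1 + n)%N => D pD.
pose a := D 0 0; pose b := ursubmx D : 'rV_n.
have DE : D = block_mx a%:M b b^T (drsubmx D).
  rewrite -[LHS]submxK; congr block_mx; last first.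
    by rewrite /b trmx_ursub (psdmx_tr pD.1).
  apply/matrixP => i j; rewrite !ord1 !mxE eqxx mulr1n /a.
  by congr (D _ _); apply: val_inj.
(* [a] is the form at the first basis vector [e], hence nonnegative; [a = 0] would give [D e = 0] by
   [psdmx_ker], against invertibility. *)
have a0 : 0 < a.
  have eDe : (delta_mx 0 0 : 'cV_(1 + n))^T *m D *m delta_mx 0 0 = a%:M :> 'M_1.
    apply/matrixP => i j; rewrite !ord1 trmx_delta -rowE -colE !mxE eqxx.
    by rewrite mulr1n.
  rewrite lt_def; have := pD.1.2 (delta_mx 0 0).
  rewrite eDe mxE eqxx mulr1n => ->; rewrite andbT; apply/eqP => az.
  have De0 : D *m delta_mx 0 0 = 0 :> 'cV_(1 + n).
    by apply: psdmx_ker pD.1 _; rewrite eDe az !mxE mul0rn.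
  have := mulKmx pD.2 (delta_mx 0 0 : 'cV_(1 + n)); rewrite De0 mulmx0.
  move=> /matrixP /(_ 0 0); rewrite !mxE !eqxx /= => /eqP.
  by rewrite eq_sym oner_eq0.
pose T : 'M[R]_(1 + n) := block_mx 1%:M (- a^-1 *: b) 0 1%:M.
pose S := drsubmx D - a^-1 *: (b^T *m b).
have uT : T \in unitmx by rewrite unitmxE det_ublock !det1 mulr1 unitr1.
have TDT : T^T *m D *m T = block_mx a%:M 0 0 S.
  rewrite {1}DE /T tr_block_mx !mulmx_block !trmx1 !trmx0 !mulmx1 !mulmx0.
  rewrite !mul0mx !mul1mx !addr0.
  have -> : (- a^-1 *: b)^T = - a^-1 *: b^T by rewrite linearZ.
  rewrite mul_scalar_mx mul_mx_scalar !scalerA mulrN mulfV ?gt_eqF //.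
  rewrite !scaleN1r !addNr mul0mx add0r.
  by rewrite /S addrC -scalemxAl scaleNr.
have pS : pdmx S.
  have [psTDT] := pdmx_congr _ _ uT pD.
  rewrite TDT block_diag_mx_unit => /andP[_ uS]; split=> //.
  (* Congruence by the block column with blocks 0 and I restricts the form to the last [n]
     coordinates, where it is [S]. *)
  have := psdmx_congr (col_mx 0 1%:M : 'M_(1 + n, n)) _ psTDT.
  rewrite TDT tr_col_mx mul_row_block trmx0 trmx1 !mul0mx !mulmx0 !add0r.
  by rewrite mul_row_col mulmx0 add0r mul1mx mulmx1.
have [Q uQ QSQ] := IHn _ pS.
(* [Q] normalizes the block [S]; the factor [s] scales the remaining pivot [a] to 1. *)
pose c := Num.sqrt a; pose s := c^-1.
have c0 : c != 0 by rewrite gt_eqF // sqrtr_gt0.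
have cE : a = c ^+ 2 by rewrite sqr_sqrtr ?ltW.
exists (T *m block_mx s%:M 0 0 Q).
  rewrite unitmx_mul uT block_diag_mx_unit uQ andbT unitmxE det_scalar1.
  by rewrite unitfE invr_neq0.
rewrite trmx_mul !mulmxA -(mulmxA _ T^T) -(mulmxA _ (T^T *m D)) TDT.
rewrite tr_block_mx !mulmx_block !trmx0 !mulmx0 !mul0mx !addr0 !add0r mul0mx.
rewrite QSQ mul0mx tr_scalar_mx -!scalar_mxM scalar_mx_block.
by congr (block_mx _%:M _ _ _); rewrite cE /s; field.
Qed.

(** * Building order isomorphisms *)

(** Reduces each case to explicit formulas in both directions. The order condition is an equality of
    propositions, so that the invariance lemmas prove it by rewriting. *)
Lemma order_isomorphic_can {R : realType} {n : nat} (M N : set 'M[R]_n)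
    (phi psi : 'M[R]_n -> 'M[R]_n) :
  (forall X, M X -> N (phi X)) -> (forall Z, N Z -> M (psi Z)) ->
  (forall X, M X -> psi (phi X) = X) -> (forall Z, N Z -> phi (psi Z) = Z) ->
  (forall X Y, M X -> M Y -> mxle (phi X) (phi Y) = mxle X Y) ->
  order_isomorphic M N.
Proof.
move=> MN NM phiK psiK le_phi; exists phi; split; last first.
  by move=> X Y MX MY; rewrite le_phi.
split=> [X MX|X Y|Z NZ]; first exact: MN.
  by rewrite !inE => MX MY eq_phi; rewrite -(phiK _ MX) eq_phi phiK.
by exists (psi Z); [exact: NM | exact: psiK].
Qed.

Lemma mxle0 {R : realType} {n : nat} (X Y : 'M[R]_n) :
  mxle 0 (Y - X) = mxle X Y.
Proof. by rewrite /mxle subr0. Qed.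

(** The converse direction is congruence by [P^-1]. *)
Lemma mxle_congr {R : realType} {n : nat} (P X Y : 'M[R]_n) :
  P \in unitmx -> mxle (P^T *m X *m P) (P^T *m Y *m P) = mxle X Y.
Proof.
move=> uP; have uPt : P^T \in unitmx by rewrite unitmx_tr.
rewrite /mxle -mulmxBl -mulmxBr; apply/propext; split; last exact: psdmx_congr.
move=> /(psdmx_congr (invmx P)).
by rewrite trmx_inv -!mulmxA mulmxV // mulmx1 mulKmx.
Qed.

Lemma Sym_sub {R : realType} {n : nat} (X Y : 'M[R]_n) :
  Sym X -> Sym Y -> Sym (X - Y).
Proof.
by move=> /symmxP sX /symmxP sY; apply/symmxP; rewrite linearB /= sX sY.
Qed.

Lemma Sym_add {R : realType} {n : nat} (X Y : 'M[R]_n) :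
  Sym X -> Sym Y -> Sym (X + Y).
Proof.
by move=> /symmxP sX /symmxP sY; apply/symmxP; rewrite linearD /= sX sY.
Qed.

(** * Bounded intervals *)

Lemma mxitv_cc_iso {R : realType} {n : nat} (A B : 'M[R]_n) :
  Sym A -> mxlt A B -> order_isomorphic (mxitv_cc A B) (mxitv_cc 0 1%:M).
Proof.
move=> sA /pdmx_congr_id [P uP PDP].
have uPt : P^T \in unitmx by rewrite unitmx_tr.
have congrV (Z : 'M_n) : P^T *m ((invmx P)^T *m Z *m invmx P) *m P = Z.
  by rewrite trmx_inv -mulmxA mulmxKV // mulKVmx.
apply: (@order_isomorphic_can _ _ _ _ (fun X => P^T *m (X - A) *m P)
  (fun Z => A + (invmx P)^T *m Z *m invmx P)).
- move=> X [sX [AX XB]]; have pX := psdmx_congr P _ AX.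
  split; [exact: pX.1 | split]; first by rewrite /mxle subr0.
  (* The upper end I is read as [P^T (B - A) P], the image of [B]. *)
  by rewrite -PDP mxle_congr // mxle_sub2r.
- move=> Z [sZ [Z0 Z1]]; rewrite /mxle subr0 in Z0.
  have pZ := psdmx_congr (invmx P) _ Z0.
  split; [exact: Sym_add pZ.1 | split]; first by rewrite /mxle addrC addKr.
  by rewrite -(mxle_sub2r A) -(mxle_congr P) // PDP [A + _]addrC addrK congrV.
- move=> X _; rewrite trmx_inv -!mulmxA mulmxV // mulmx1 mulKmx //.
  by rewrite addrC subrK.
- by move=> Z _; rewrite [A + _]addrC addrK congrV.
- by move=> X Y _ _; rewrite mxle_congr // mxle_sub2r.
Qed.

(** Reflection and inversion each reverse the order, so [(B - X)^-1] preserves it; the open end [B]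
    goes to infinity, and the closed end [A] goes to [E], which the translation moves to 0. *)
Lemma mxitv_co_iso {R : realType} {n : nat} (A B : 'M[R]_n) :
  Sym B -> mxlt A B -> order_isomorphic (mxitv_co A B) (mxitv_ci 0).
Proof.
move=> sB pD; have pE := pdmx_inv pD; set E := invmx (B - A) in pE.
have pZE Z : mxitv_ci 0 Z -> pdmx (Z + E).
  by move=> [_ +]; rewrite /mxle subr0 addrC; exact: pdmx_add_psd.
apply: (@order_isomorphic_can _ _ _ _ (fun X => invmx (B - X) - E)
  (fun Z => B - invmx (Z + E))).
- move=> X [sX [AX XB]]; split; last by rewrite mxle0 mxle_inv // mxle_sub2l.
  by apply: Sym_sub; [exact: (pdmx_inv XB).1.1 | exact: pE.1.1].
- move=> Z NZ; have pZ := pZE Z NZ; have piZ := pdmx_inv pZ.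
  split; [exact: Sym_sub piZ.1.1 | split]; last by rewrite /mxlt subKr.
  (* Reflecting in [B] turns the lower bound into [(Z + E)^-1 <= E^-1], that is [E <= Z + E]. *)
  rewrite -(mxle_sub2l B) subKr -(invmxK (B - A)) mxle_inv // -/E.
  by rewrite -mxle0 addrK; case: NZ.
- by move=> X _; rewrite subrK invmxK subKr.
- by move=> Z _; rewrite subKr invmxK addrK.
- by move=> X Y [_ [_ XB]] [_ [_ YB]]; rewrite mxle_sub2r mxle_inv // mxle_sub2l.
Qed.

(** [(X - A)^-1] reverses the order, sends the open end [A] to infinity and [B] to [E]; subtracting
    it from [E] restores the order and puts the closed end at 0. *)
Lemma mxitv_oc_iso {R : realType} {n : nat} (A B : 'M[R]_n) :
  Sym A -> mxlt A B -> order_isomorphic (mxitv_oc A B) (mxitv_ic 0).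
Proof.
move=> sA pD; have pE := pdmx_inv pD; set E := invmx (B - A) in pE.
have pEZ Z : mxitv_ic 0 Z -> pdmx (E - Z).
  by move=> [_ +]; rewrite /mxle sub0r; exact: pdmx_add_psd.
apply: (@order_isomorphic_can _ _ _ _ (fun X => E - invmx (X - A))
  (fun Z => A + invmx (E - Z))).
- move=> X [sX [AX XB]]; split.
    by apply: Sym_sub; [exact: pE.1.1 | exact: (pdmx_inv AX).1.1].
  by rewrite -[0](subrr E) mxle_sub2l mxle_inv // mxle_sub2r.
- move=> Z NZ; have pZ := pEZ Z NZ; have piZ := pdmx_inv pZ.
  split; [exact: Sym_add piZ.1.1 | rewrite addrC; split].
    by rewrite /mxlt addrK.
  rewrite -(mxle_sub2r A) addrK -(invmxK (B - A)) mxle_inv // -/E.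
  by rewrite -{1}[E]subr0 mxle_sub2l; case: NZ.
- by move=> X _; rewrite subKr invmxK addrC subrK.
- by move=> Z _; rewrite [A + _]addrC addrK invmxK subKr.
- by move=> X Y [_ [AX _]] [_ [AY _]]; rewrite mxle_sub2l mxle_inv // mxle_sub2r.
Qed.

(** The first inversion sends [A] to infinity and [B] to [E]; after translation by [E] the image is
    the open cone with the order reversed, and a second inversion of that cone restores the
    order. *)
Lemma mxitv_oo_iso {R : realType} {n : nat} (A B : 'M[R]_n) :
  Sym A -> mxlt A B -> order_isomorphic (mxitv_oo A B) (mxitv_oi 0).
Proof.
move=> sA pD; have pE := pdmx_inv pD; set E := invmx (B - A) in pE.
have pZ0 Z : mxitv_oi 0 Z -> pdmx Z by rewrite /mxitv_oi /= /mxlt subr0 => -[].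
have pZE Z : mxitv_oi 0 Z -> pdmx (invmx Z + E).
  by move=> /pZ0 pZ; apply: pdmx_add_psd pE.1; exact: pdmx_inv.
have pXE X : mxitv_oo A B X -> pdmx (invmx (X - A) - E).
  move=> [sX [AX XB]]; change (mxlt E (invmx (X - A))).
  by rewrite mxlt_inv // /mxlt opprB addrA subrK.
apply: (@order_isomorphic_can _ _ _ _ (fun X => invmx (invmx (X - A) - E))
  (fun Z => A + invmx (invmx Z + E))).
- move=> X /pXE /pdmx_inv pX; split; first exact: pX.1.1.
  by rewrite /mxlt subr0.
- move=> Z NZ; have pZ := pZE Z NZ; have piZ := pdmx_inv pZ.
  split; [exact: Sym_add piZ.1.1 | split].
    by rewrite /mxlt addrC addKr.
  (* The bound by [B] amounts to [(Z^-1 + E)^-1 < E^-1], which holds because [Z^-1] is positive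
     definite. *)
  have : mxlt (invmx (invmx Z + E)) (invmx E).
    by rewrite mxlt_inv // /mxlt addrK; exact/pdmx_inv/pZ0.
  by rewrite /mxlt invmxK opprD addrA.
- by move=> X _; rewrite invmxK subrK invmxK addrC subrK.
- by move=> Z _; rewrite [A + _]addrC addrK invmxK addrK invmxK.
- move=> X Y MX MY; rewrite mxle_inv ?mxle_sub2r; [|exact: pXE..].
  by rewrite mxle_inv ?mxle_sub2r //; [case: MY => _ [] | case: MX => _ []].
Qed.

(** * Half-infinite intervals *)

Lemma mxitv_ci_iso {R : realType} {n : nat} (A : 'M[R]_n) :
  Sym A -> order_isomorphic (mxitv_ci A) (mxitv_ci 0).
Proof.
move=> sA; apply: (@order_isomorphic_can _ _ _ _ (fun X => X - A)
  (fun Z => Z + A)).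
- by move=> X [sX AX]; split; [exact: Sym_sub | rewrite mxle0].
- by move=> Z [sZ Z0]; split; [exact: Sym_add | rewrite -mxle0 addrK].
- by move=> X _; rewrite subrK.
- by move=> Z _; rewrite addrK.
- by move=> X Y _ _; rewrite mxle_sub2r.
Qed.

Lemma mxitv_oi_iso {R : realType} {n : nat} (A : 'M[R]_n) :
  Sym A -> order_isomorphic (mxitv_oi A) (mxitv_oi 0).
Proof.
move=> sA; apply: (@order_isomorphic_can _ _ _ _ (fun X => X - A)
  (fun Z => Z + A)).
- by move=> X [sX AX]; split; [exact: Sym_sub | rewrite /mxlt subr0].
- move=> Z [sZ Z0]; split; first exact: Sym_add.
  by move: Z0; rewrite /mxlt subr0 addrK.
- by move=> X _; rewrite subrK.
- by move=> Z _; rewrite addrK.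
- by move=> X Y _ _; rewrite mxle_sub2r.
Qed.

Lemma mxitv_ic_iso {R : realType} {n : nat} (A : 'M[R]_n) :
  Sym A -> order_isomorphic (mxitv_ic A) (mxitv_ic 0).
Proof.
move=> sA; apply: (@order_isomorphic_can _ _ _ _ (fun X => X - A)
  (fun Z => Z + A)).
- move=> X [sX XA]; split; first exact: Sym_sub.
  by rewrite -[0](subrr A) mxle_sub2r.
- move=> Z [sZ Z0]; split; first exact: Sym_add.
  by rewrite -(mxle_sub2r A) addrK subrr.
- by move=> X _; rewrite subrK.
- by move=> Z _; rewrite addrK.
- by move=> X Y _ _; rewrite mxle_sub2r.
Qed.

(** Reflection in [A] gives the open cone with the order reversed; inversion maps this cone onto
    itself and reverses the order back. *)
Lemma mxitv_io_iso {R : realType} {n : nat} (A : 'M[R]_n) :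
  Sym A -> order_isomorphic (mxitv_io A) (mxitv_oi 0).
Proof.
move=> sA.
have pZ0 Z : mxitv_oi 0 Z -> pdmx Z by rewrite /mxitv_oi /= /mxlt subr0 => -[].
apply: (@order_isomorphic_can _ _ _ _ (fun X => invmx (A - X))
  (fun Z => A - invmx Z)).
- move=> X [_ /pdmx_inv pX]; split; first exact: pX.1.1.
  by rewrite /mxlt subr0.
- move=> Z /pZ0 /pdmx_inv pZ; split; first exact: Sym_sub pZ.1.1.
  by rewrite /mxlt subKr.
- by move=> X _; rewrite invmxK subKr.
- by move=> Z _; rewrite subKr invmxK.
- by move=> X Y [_ XA] [_ YA]; rewrite mxle_inv // mxle_sub2l.
Qed.

(** * Classification over the nine kinds of interval *)

Theorem theorem5p1 (R : realType) (n : nat) (hn : (2 <= n)%N)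
    (J : set 'M[R]_n) (hJ : matrix_interval J) :
  order_isomorphic J (mxitv_cc (0 : 'M[R]_n) 1%:M) \/
  order_isomorphic J (mxitv_ci (0 : 'M[R]_n)) \/
  order_isomorphic J (mxitv_ic (0 : 'M[R]_n)) \/
  order_isomorphic J (mxitv_oi (0 : 'M[R]_n)) \/
  order_isomorphic J (mxitv_ii R n).
Proof.
case: hJ => [A B sA sB AB|A B sA sB AB|A B sA sB AB|A B sA sB AB|A sA|A sA
  |A sA|A sA|].
- by left; exact: mxitv_cc_iso.
- by right; left; exact: mxitv_co_iso.
- by do 2 right; left; exact: mxitv_oc_iso.
- by do 3 right; left; exact: mxitv_oo_iso.
- by right; left; exact: mxitv_ci_iso.
- by do 3 right; left; exact: mxitv_oi_iso.
- by do 2 right; left; exact: mxitv_ic_iso.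
- by do 3 right; left; exact: mxitv_io_iso.
- by do 4 right; exact: (@order_isomorphic_can _ _ _ _ id id).
Qed.
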